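(* Let $r\ge 1$, let $p$ be a prime and let $e_1,\ldots,e_r\in\mathbb{N}$ satisfy $e:=e_1=e_2=\cdots=e_s>e_{s+1}\ge e_{s+2}\ge\cdots\ge e_r\ge 1$ for some $s$ with $1\le s\le r$. Put $v=\sum_{j=1}^r e_j-r-e+1$ and $h_s(x)=\frac{(x-1)^{s-1}+(-1)^s}{x}$ (a polynomial of degree $s-2$ for $s>1$). Then $$R(p^{e_1},\ldots,p^{e_r})=\begin{cases}p^{v+e}(p-1)^{r-s+1}h_s(p), & e>1,\\ (p-1)^r+(-1)^r(p-2), & e=1.\end{cases}$$
   Context: For $n\in\mathbb{N}$ and $k\in\mathbb{Z}$, $c_n(k)=\sum_{1\le j\le n,\ \gcd(j,n)=1}\exp(2\pi i jk/n)$ is the Ramanujan sum. For $m_1,\ldots,m_r\in\mathbb{N}$ with $m=\operatorname{lcm}(m_1,\ldots,m_r)$, $R(m_1,\ldots,m_r)=\sum_{1\le k\le m,\ \gcd(k,m)=1} c_{m_1}(k-1)\cdots c_{m_r}(k-1)$. *)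

(* Defs.v *)
From HB Require Import structures.
From mathcomp Require Import all_boot all_order all_algebra.
From mathcomp Require Import complex.
From mathcomp Require Import reals sequences exp trigo.

Set Implicit Arguments.
Unset Strict Implicit.
Unset Printing Implicit Defensive.

Import Order.TTheory GRing.Theory Num.Theory.

Local Open Scope ring_scope.
Local Open Scope complex_scope.

Definition expC (R : realType) (z : R[i]) : R[i] :=
  let: x +i* y := z in (expR x)%:C * (cos y +i* sin y).

Definition ramanujan_sum (R : realType) (n : nat) (k : int) : R[i] :=
  \sum_(1 <= j < n.+1 | coprime j n)
     expC (2 * (pi : R)%:C * 'i%C * j%:R * k%:~R / n%:R).

(* R(m_1, ..., m_r); the lcm of the family is taken in nat, and k - 1 is an
   integer subtraction. *)
Definition ramanujan_R (R : realType) (r : nat) (m : 'I_r -> nat) : R[i] :=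
  let M := \big[lcmn/1%N]_(i < r) m i in
  \sum_(1 <= k < M.+1 | coprime k M)
     \prod_(i < r) ramanujan_sum R (m i) (k%:Z - 1).

(* Only meaningful for s >= 1 and x != 0. *)
Definition h_fun (F : fieldType) (s : nat) (x : F) : F :=
  ((x - 1) ^+ (s - 1) + (-1) ^+ s) / x.

(* Main.v *)
(* Subtracting from the sum over all residues the one over multiples of p, and
   using orthogonality of the powers of a primitive root of unity, gives
   c_{p^(b+1)}(m) = p^(b+1) [p^(b+1) | m] - p^b [p^b | m].  Hence for e > 1 only
   the terms k = 1 + p^(e-1) t, 0 <= t < p, of R(p^(e_1), ..., p^(e_r)) survive,
   and they are automatically coprime to p.  After factoring out the product of
   the p^(e_i - 1), the term t = 0 contributes (p-1)^r and each of the p-1 others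
   (-1)^s (p-1)^(r-s).  For e = 1 the constraint gcd(k, p) = 1 removes one residue,
   so that p - 2 of the latter terms remain. *)
Require Import Defs.
From HB Require Import structures.
From mathcomp Require Import all_boot all_order all_algebra.
From mathcomp Require Import complex.
From mathcomp Require Import reals sequences exp trigo.
From mathcomp Require Import ring.

Import Order.TTheory GRing.Theory Num.Theory.

Local Open Scope ring_scope.

(** * Primitive roots of unity and their power sums *)

Definition cis {R : realType} (x : R) : R[i] := (cos x +i* sin x)%C.

Lemma cisX (R : realType) (x : R) (n : nat) : cis x ^+ n = cis (x *+ n).
Proof.
elim: n => [|n IHn]; first by rewrite expr0 mulr0n /cis cos0 sin0.
rewrite exprSr IHn mulrSr /cis cosD sinD.
by apply/eqP; rewrite eq_complex /= eqxx /= addrC.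
Qed.

(** The order [m] of this root divides [n]. If [m < n], then [cos (2 pi m / n) = 1], which forces
    [sin (pi m / n) = 0] although the angle lies strictly between 0 and [pi]. *)
Lemma prim_root_cis {R : realType} {n : nat} :
  (0 < n)%N -> n.-primitive_root (cis (pi *+ 2 / n%:R : R)).
Proof.
move=> n_gt0; have n_neq0 : n%:R != 0 :> R by rewrite pnatr_eq0 -lt0n.
have zn1 : cis (pi *+ 2 / n%:R : R) ^+ n = 1.
  rewrite cisX -[_ *+ n]mulr_natr divfK // /cis cos2pi.
  by rewrite mulr2n sinD sinpi mul0r mulr0 addr0.
have [m prim_m m_dvd_n] := prim_order_exists n_gt0 zn1.
suff n_eq_m : n = m by rewrite [X in X.-primitive_root _]n_eq_m.
apply/eqP; apply: contraT => n_neq_m.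
have m_gt0 := prim_order_gt0 prim_m.
have m_lt_n : (m < n)%N by rewrite ltn_neqAle eq_sym n_neq_m dvdn_leq.
have := prim_expr_order prim_m; rewrite cisX => /(congr1 (@complex.Re R)) /=.
(* [1 - cos (2 y) = 2 (sin y)^2] does not vanish for [0 < y < pi]. *)
have -> : pi *+ 2 / n%:R *+ m = (pi * (m%:R / n%:R)) *+ 2 :> R.
  by ring.
have : 0 < sin (pi * (m%:R / n%:R) : R).
  apply: sin_gt0_pi; rewrite mulr_gt0 ?pi_gt0 ?divr_gt0 ?ltr0n //=.
  by rewrite gtr_pMr ?pi_gt0 // ltr_pdivrMr ?ltr0n // mul1r ltr_nat.
rewrite cos_mulr2n -[cos _ ^+ 2](addrK (sin (pi * (m%:R / n%:R)) ^+ 2)).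
rewrite cos2Dsin2; set t := sin _ => t_gt0 /eqP.
have -> : (1 - t ^+ 2) *+ 2 - 1 = 1 - t ^+ 2 *+ 2 by ring.
rewrite -subr_eq0 addrAC subrr add0r oppr_eq0 mulrn_eq0 /= expf_eq0 /=.
by rewrite gt_eqF.
Qed.

Lemma expC_cis (R : realType) (n j m : nat) :
  expC (2 * (pi : R)%:C * 'i * j%:R * (m%:Z)%:~R / n%:R)%C =
  cis (pi *+ 2 / n%:R) ^+ (j * m).
Proof.
have -> : (2 * (pi : R)%:C * 'i * j%:R * (m%:Z)%:~R / n%:R)%C =
    (0 +i* (pi *+ 2 / n%:R *+ (j * m)))%C.
  have -> (y : R) : (0 +i* y)%C = (y%:C * 'i)%C by simpc.
  rewrite -[_ *+ (j * m)]mulr_natr -(mulr_natr pi) natrM !rmorphM fmorphV !rmorph_nat.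
  rewrite -pmulrn; ring.
by rewrite cisX /= expR0 mul1r.
Qed.

Lemma sum_prim_root (F : idomainType) (n m : nat) (z : F) :
  n.-primitive_root z ->
  \sum_(0 <= j < n) z ^+ (j * m) = if (n %| m)%N then n%:R else 0.
Proof.
move=> prim_z; rewrite (prim_order_dvd prim_z) big_mkord.
under eq_bigr do rewrite mulnC exprM.
have [->|zm_neq1] := eqVneq.
  by under eq_bigr do rewrite expr1n; rewrite sumr_const card_ord.
(* Geometric series: [z^m - 1], here nonzero, times the sum is [z^(m n) - 1 = 0]. *)
apply/eqP; have /eqP := subrX1 (z ^+ m) n.
rewrite -exprM mulnC exprM (prim_expr_order prim_z) expr1n subrr eq_sym mulf_eq0.
by rewrite subr_eq0 (negPf zm_neq1).
Qed.

Lemma sum_multiples (V : nmodType) (d N : nat) (F : nat -> V) :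
  (0 < d)%N ->
  \sum_(0 <= j < d * N | (d %| j)%N) F j = \sum_(0 <= t < N) F (d * t)%N.
Proof.
move=> d_gt0; elim: N => [|N IHN]; first by rewrite muln0 !big_geq.
rewrite big_nat_recr // -IHN (@big_cat_nat _ _ _ (d * N)) ?leq_mul //=.
have d_lt : (d * N < d * N.+1)%N by rewrite ltn_pmul2l.
(* In the new block of length [d] only its first index [d * N] is a multiple of [d]. *)
congr (_ + _); rewrite big_ltn_cond // dvdn_mulr //.
rewrite big_nat_cond big_pred0 ?addr0 // => j.
apply/negP => /andP[/andP[lt1 lt2] /dvdnP[q jq]]; move: lt1 lt2.
by rewrite jq (mulnC q) !ltn_pmul2l // ltnS; case: ltnP.
Qed.

(** * Ramanujan sums at prime powers *)

Lemma ramanujan_sum_pfactor (R : realType) (p b m : nat) :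
  prime p ->
  ramanujan_sum R (p ^ b.+1) m%:Z =
  (if (p ^ b.+1 %| m)%N then (p ^ b.+1)%:R else 0)
  - (if (p ^ b %| m)%N then (p ^ b)%:R else 0).
Proof.
move=> p_pr; have p_gt0 := prime_gt0 p_pr.
have n_gt0 : (0 < p ^ b.+1)%N by rewrite expn_gt0 p_gt0.
have prim_z := prim_root_cis (R := R) n_gt0.
rewrite /ramanujan_sum; under eq_bigr do rewrite expC_cis.
move: prim_z; set z := cis _ => prim_z.
under eq_bigl => j do rewrite coprime_pexpr // coprime_sym prime_coprime //.
rewrite -(sum_prim_root _ _ m _ prim_z) [X in _ = X - _](bigID (fun j => p %| j)%N) /=.
(* [z ^+ p] has order [p ^ b], so the multiples of [p] form an orthogonality sum one level lower. *)
have prim_zp : (p ^ b).-primitive_root (z ^+ p).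
  have := dvdn_prim_root prim_z (dvdn_exp2l p (leqnSn b)).
  by rewrite expnSr mulKn // expn_gt0 p_gt0.
have -> : \sum_(0 <= j < p ^ b.+1 | (p %| j)%N) z ^+ (j * m) =
    if (p ^ b %| m)%N then (p ^ b)%:R else 0.
  rewrite expnS sum_multiples // -(sum_prim_root _ _ m _ prim_zp).
  by apply: eq_bigr => j _; rewrite -mulnA exprM.
(* One sum starts at 1 and includes [p ^ b.+1], the other starts at 0 and excludes it; both end
   indices are multiples of [p] and drop out. *)
rewrite addrAC subrr add0r !(big_mkcond (fun j => ~~ _)).
rewrite big_nat_recr //= dvdn_exp //= addr0.
by rewrite [RHS]big_ltn //= dvdn0 add0r.
Qed.

Lemma ramanujan_sum_pfactor_multiple (R : realType) (p b m : nat) :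
  prime p -> (p ^ b %| m)%N ->
  ramanujan_sum R (p ^ b.+1) m%:Z =
  (p ^ b)%:R * (if (p ^ b.+1 %| m)%N then p%:R - 1 else -1).
Proof.
move=> p_pr pb_dvd; rewrite ramanujan_sum_pfactor // pb_dvd expnSr natrM.
by case: ifP => _; ring.
Qed.

Lemma ramanujan_sum_pfactor_eq0 (R : realType) (p b m : nat) :
  prime p -> ~~ (p ^ b %| m)%N -> ramanujan_sum R (p ^ b.+1) m%:Z = 0.
Proof.
move=> p_pr pb_ndvd; rewrite ramanujan_sum_pfactor // (negPf pb_ndvd) subr0.
case: ifP => // /(dvdn_trans _) dvd_m.
by rewrite dvd_m // dvdn_exp2l in pb_ndvd.
Qed.

Lemma biglcmn_pfactor (r p e : nat) (a : 'I_r -> nat) (i0 : 'I_r) :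
  a i0 = e -> (forall i, (a i <= e)%N) ->
  \big[lcmn/1%N]_(i < r) (p ^ a i)%N = (p ^ e)%N.
Proof.
move=> a0 a_le; apply/eqP; rewrite eqn_dvd; apply/andP; split.
  by apply/dvdn_biglcmP => i _; rewrite dvdn_exp2l.
by apply: (biglcmn_sup i0) => //; rewrite a0.
Qed.

Lemma eq_ramanujan_R (R : realType) (r : nat) (m1 m2 : 'I_r -> nat) :
  m1 =1 m2 -> ramanujan_R R m1 = ramanujan_R R m2.
Proof.
move=> m12; rewrite /ramanujan_R (eq_bigr m2) => [|i _]; last exact: m12.
by apply: eq_bigr => k _; apply: eq_bigr => i _; rewrite m12.
Qed.

(** Indexing by [k - 1] turns the integer argument into a natural number, so that divisibility in
    [nat] applies. *)
Lemma ramanujan_R_shift (R : realType) (r M : nat) (m : 'I_r -> nat) :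
  \big[lcmn/1%N]_(i < r) m i = M ->
  ramanujan_R R m =
  \sum_(0 <= k < M | coprime k.+1 M) \prod_(i < r) ramanujan_sum R (m i) k%:Z.
Proof.
move=> lcm_m; rewrite /ramanujan_R lcm_m big_add1 /=.
by apply: eq_bigr => k _; rewrite -addn1 PoszD addrK.
Qed.

Lemma prod_ord_if_lt (A : comPzRingType) (r s : nat) (x y : A) :
  (s <= r)%N ->
  \prod_(i < r) (if (i < s)%N then x else y) = x ^+ s * y ^+ (r - s).
Proof.
move=> /subnKC s_le; rewrite -[in LHS]s_le big_split_ord /=.
under eq_bigr do rewrite ltn_ord.
under [X in _ * X]eq_bigr do rewrite ltnNge leq_addr /=.
by rewrite !prodr_const !card_ord.
Qed.

(** The numerator is monic of degree [s - 1] and vanishes at 0, because [(-1)^(s-1) + (-1)^s = 0];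
    hence [X] divides it. *)
Lemma h_fun_poly (F : fieldType) (s : nat) :
  (1 < s)%N ->
  exists q : {poly F}, size q = (s - 1)%N /\ forall x, x != 0 -> q.[x] = h_fun s x.
Proof.
case: s => [|[|s]] // _; rewrite subSS subn0.
pose f : {poly F} := ('X - 1%:P) ^+ s.+1 + ((-1) ^+ s.+2)%:P.
have /factor_theorem[q fE] : root f 0.
  by rewrite rootE !hornerE /= [X in _ + X]exprS mulN1r addrN.
have sz_f : size f = s.+2.
  by rewrite size_polyDl size_exp_XsubC // ltnS (leq_trans (size_polyC_leq1 _)).
exists q; split=> [|x x_neq0].
  have q_neq0 : q != 0.
    by apply/eqP => q0; move: sz_f; rewrite fE q0 mul0r size_poly0.
  have := sz_f; rewrite fE size_Mmonic ?monicXsubC // size_XsubC addn2 /=.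
  by move=> [].
rewrite /h_fun subSS subn0.
have -> : (x - 1) ^+ s.+1 + (-1) ^+ s.+2 = f.[x] by rewrite !hornerE.
by rewrite fE !hornerE /= subr0 mulfK.
Qed.

(** * Evaluation of [R] at powers of [p] *)

Lemma prod_ramanujan_sum_pfactor (R : realType) (r p m : nat) (b : 'I_r -> nat) :
  prime p -> (forall i, (p ^ b i %| m)%N) ->
  \prod_(i < r) ramanujan_sum R (p ^ (b i).+1) m%:Z =
  p%:R ^+ (\sum_(i < r) b i)%N
  * \prod_(i < r) (if (p ^ (b i).+1 %| m)%N then p%:R - 1 else -1).
Proof.
move=> p_pr pb_dvd; rewrite -prodrXr -big_split /=; apply: eq_bigr => i _.
by rewrite ramanujan_sum_pfactor_multiple // natrX.
Qed.

Lemma ramanujan_R_prime (R : realType) (r p : nat) :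
  (0 < r)%N -> prime p ->
  ramanujan_R R (fun _ : 'I_r => p) =
  (p%:R - 1) ^+ r + (-1) ^+ r * (p%:R - 2).
Proof.
move=> r_gt0 p_pr.
have lcm_p : \big[lcmn/1%N]_(i < r) p = p.
  exact: (biglcmn_pfactor r p 1 (fun=> 1%N) (Ordinal r_gt0)).
rewrite (ramanujan_R_shift _ _ p) //.
have prodE k : \prod_(i < r) ramanujan_sum R p k%:Z =
    (if (p %| k)%N then p%:R - 1 else -1) ^+ r.
  rewrite (prod_ramanujan_sum_pfactor R r p k (fun=> 0%N)) //.
  by rewrite big1 // mul1r prodr_const card_ord.
under eq_bigr do rewrite prodE.
(* Writing [p = q + 2] exposes the index [k = p - 1], removed by coprimality, and [k = 0]; exactly
   [q] equal terms remain. *)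
case: p p_pr {lcm_p prodE} => [|[|q]] // p_pr.
rewrite big_mkcond /= big_nat_recr //= /coprime gcdnn /= addr0.
rewrite big_ltn //= gcd1n eqxx; congr (_ + _).
rewrite (eq_big_nat _ _ (F2 := fun=> (-1) ^+ r)) => [|k /andP[k_gt0 k_lt]].
  rewrite sumr_const_nat subSS subn0 -[LHS]mulr_natr; congr (_ * _).
  by rewrite -addn2 natrD addrK.
rewrite -/(coprime _ _) coprime_sym prime_coprime // !gtnNdvd //.
exact: ltnW.
Qed.

(** Here [b i] is [e_i - 1] and [f] is [e - 1], which avoids predecessors; [0 < f] is the case
    [e > 1]. *)
Lemma ramanujan_R_pfactor (R : realType) (r p s f : nat) (b : 'I_r -> nat) :
  prime p -> (0 < s <= r)%N -> (0 < f)%N ->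
  (forall i : 'I_r, (i < s)%N -> b i = f) ->
  (forall i : 'I_r, (s <= i)%N -> (b i < f)%N) ->
  ramanujan_R R (fun i : 'I_r => (p ^ (b i).+1)%N) =
  p%:R ^+ (\sum_(i < r) b i)%N
  * ((p%:R - 1) ^+ r + (-1) ^+ s * (p%:R - 1) ^+ (r - s).+1).
Proof.
move=> p_pr /andP[s_gt0 s_le] f_gt0 b_eq b_lt; have p_gt0 := prime_gt0 p_pr.
have b_le i : (b i <= f)%N.
  by have [/b_eq->|/b_lt/ltnW] := ltnP i s.
pose i0 := Ordinal (leq_trans s_gt0 s_le).
rewrite (ramanujan_R_shift _ _ (p ^ f.+1)); last first.
  by apply: (biglcmn_pfactor _ _ _ _ i0) => [|i]; [rewrite b_eq|rewrite ltnS].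
rewrite expnSr.
rewrite [LHS](_ : _ = \sum_(0 <= k < p ^ f * p | (p ^ f %| k)%N)
    \prod_(i < r) ramanujan_sum R (p ^ (b i).+1) k%:Z); last first.
  (* If [p ^ f] divides [k], then so does [p], and [k.+1] is prime to [p]; otherwise the factor at
     [i0] vanishes, since [b i0 = f]. *)
  rewrite big_mkcond [RHS]big_mkcond; apply: eq_bigr => k _ /=.
  rewrite -expnSr coprime_pexpr //; case: (boolP (p ^ f %| k)%N) => [dvd_k|ndvd_k].
    rewrite coprime_sym prime_coprime // -addn1 dvdn_addr ?dvdn1 ?ifT //.
      by rewrite neq_ltn prime_gt1 ?orbT.
    by apply: dvdn_trans dvd_k; rewrite dvdn_exp.
  rewrite (bigD1 i0) //= (ramanujan_sum_pfactor_eq0 R p (b i0)) ?mul0r ?if_same //.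
  by rewrite b_eq.
rewrite sum_multiples ?expn_gt0 ?p_gt0 //.
have dvd_pf t i : (p ^ b i %| p ^ f * t)%N by rewrite dvdn_mulr // dvdn_exp2l.
under eq_bigr => t _ do rewrite (prod_ramanujan_sum_pfactor _ _ _ _ _ p_pr (dvd_pf t)).
rewrite -big_distrr /=; congr (_ * _).
rewrite big_ltn // muln0; congr (_ + _).
  by under eq_bigr do rewrite dvdn0; rewrite prodr_const card_ord.
(* The [p - 1] terms with [0 < t < p] coincide; their number supplies the extra factor in the
   exponent [(r - s).+1]. *)
rewrite (eq_big_nat _ _ (F2 := fun=> (-1) ^+ s * (p%:R - 1) ^+ (r - s))).
  by rewrite sumr_const_nat -[LHS]mulr_natr natrB // exprSr mulrA.
move=> t /andP[t_gt0 t_lt]; rewrite -prod_ord_if_lt //; apply: eq_bigr => i _.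
have [i_lt|i_ge] := ltnP i s.
  by rewrite b_eq // expnSr dvdn_pmul2l ?expn_gt0 ?p_gt0 // gtnNdvd.
by rewrite dvdn_mulr // dvdn_exp2l // b_lt.
Qed.

Theorem theorem3 (R : realType) (r : nat) (hr : (1 <= r)%N)
    (p : nat) (hp : prime p) (s : nat) (hs : (1 <= s <= r)%N)
    (a : 'I_r -> nat) (e : nat)
    (ha_eq : forall i : 'I_r, (i < s)%N -> a i = e)
    (ha_lt : forall i : 'I_r, (s <= i)%N -> (a i < e)%N)
    (ha_mono : forall i j : 'I_r, (s <= i)%N -> (i <= j)%N -> (a j <= a i)%N)
    (ha_pos : forall i : 'I_r, (1 <= a i)%N) :
  let v : int := \sum_(i < r) (a i)%:Z - r%:Z - e%:Z + 1 in
  [/\ (1 < e)%N ->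
        ramanujan_R R (fun i : 'I_r => (p ^ a i)%N)
        = (p%:R : R[i]) ^ (v + e%:Z) * (p%:R - 1) ^+ (r - s + 1)
          * h_fun s (p%:R : R[i]),
      e = 1%N ->
        ramanujan_R R (fun i : 'I_r => (p ^ a i)%N)
        = (p%:R - 1 : R[i]) ^+ r + (-1) ^+ r * (p%:R - 2)
    & (1 < s)%N ->
        exists q : {poly R[i]},
          size q = (s - 1)%N
          /\ (forall x : R[i], x != 0 -> q.[x] = h_fun s x)].
Proof.
move=> v; have /andP[s_gt0 s_le] := hs.
have aE i : a i = (a i).-1.+1 by rewrite prednK.
split=> [e_gt1|e1|]; last exact: h_fun_poly.
  rewrite (eq_ramanujan_R _ _ _ (fun i => p ^ (a i).-1.+1)%N) => [|i]; last first.
    by rewrite -aE.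
  rewrite (ramanujan_R_pfactor _ _ _ s e.-1) //; first last.
  - by move=> i /ha_lt; rewrite [X in (X < _)%N]aE -{1}(prednK (ltnW e_gt1)).
  - by move=> i /ha_eq ->.
  - by rewrite -ltnS prednK // ltnW.
  (* The integer exponent is a natural number, one more than the power of [p] found above. *)
  have -> : v + e%:Z = (\sum_(i < r) (a i).-1).+1%:Z.
    rewrite /v addrAC subrK -addn1 PoszD; congr (_ + _).
    apply/eqP; rewrite subr_eq -(big_morph Posz PoszD (erefl 0)) -PoszD; apply/eqP; congr Posz.
    rewrite -[X in (_ + X)%N]card_ord -sum1_card -big_split /=.
    by apply: eq_bigr => i _; rewrite addn1.
  have p_neq0 : p%:R != 0 :> R[i] by rewrite pnatr_eq0 -lt0n prime_gt0.
  rewrite /h_fun -exprnP (exprSr p%:R) addn1.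
  (* Taking out [(p-1)^(r-s+1)] leaves [(p-1)^(s-1) + (-1)^s], and the spare factor [p] cancels the
     denominator of [h_fun]. *)
  have -> : (p%:R - 1) ^+ r = (p%:R - 1) ^+ (r - s).+1 * (p%:R - 1) ^+ (s - 1) :> R[i].
    by rewrite -exprD addSnnS subn1 prednK // subnK.
  have regroup (F : fieldType) (x c t u w : F) : x != 0 ->
      c * (t * u + w * t) = c * x * t * ((u + w) / x).
    by move=> x_neq0; field.
  exact: regroup.
(* An index [i >= s] would give [1 <= a i < 1], so all exponents equal 1. *)
have a1 i : a i = 1%N.
  have [/ha_eq->//|/ha_lt] := ltnP i s.
  by rewrite e1 ltnNge ha_pos.
rewrite -ramanujan_R_prime //; apply: eq_ramanujan_R => i.
by rewrite a1.
Qed.
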